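(* Let $G$ be a finite simple graph with $n$ vertices and $\alpha(G)>n/2$. Then: (i) if the number of isolated vertices of $G$ is not $1$, then $\xi(G)\geq 2$; (ii) if $\xi(G)=1$, then $G$ has exactly one isolated vertex; (iii) $\xi(G)=0$ never holds.
   Context: $\alpha(G)$ is the maximum size of a stable set of $G$; $\Omega(G)$ is the set of maximum stable sets; $core(G)=\bigcap\{S:S\in\Omega(G)\}$ and $\xi(G)=|core(G)|$. *)

(* Defs.v *)
From mathcomp Require Import all_boot.

Set Implicit Arguments.
Unset Strict Implicit.
Unset Printing Implicit Defensive.

(* A finite simple graph is a symmetric irreflexive adjacency relation [e] on
   a finType [T] of vertices; the definitions below take any relation. *)
Section Graph.
Variables (T : finType) (e : rel T).

Definition stable (S : {set T}) : bool :=
  [forall x in S, forall y in S, ~~ e x y].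

Definition alpha : nat := \max_(S : {set T} | stable S) #|S|.

Definition Omega : {set {set T}} :=
  [set S : {set T} | stable S && (#|S| == alpha)].

(* [Omega] is never empty, since [set0] is stable, so this intersection never
   takes the conventional empty-family value [setT]. *)
Definition core : {set T} := \bigcap_(S in Omega) S.

Definition xi : nat := #|core|.

Definition isolated : {set T} := [set x | [forall y, ~~ e x y]].

End Graph.

(* Main.v *)
Require Import Defs.
From mathcomp Require Import all_boot zify.

(** Maximum stable sets S_1, ..., S_k with intersection A and union B satisfy
    2 alpha <= |A| + |B|: adding one more maximum stable set S, the set
    A ∪ (S ∩ B) is stable, so |A \ S| <= |S \ B|. For the family of all maximum
    stable sets, the union avoids N(core), hence
    |core| >= |N(core)| + 2 alpha - n > |N(core)|. So the core is nonempty, and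
    if it is a single vertex then N(core) is empty and that vertex is isolated;
    conversely every isolated vertex lies in the core. *)

Section MaximumStableSets.
Variables (T : finType) (e : rel T).
Hypothesis e_sym : symmetric e.

Lemma stableP {S : {set T}} :
  reflect {in S &, forall x y, ~~ e x y} (stable e S).
Proof.
apply: (iffP forall_inP) => [st x y xS yS | st x xS].
  exact: (forall_inP (st x xS)).
by apply/forall_inP => y yS; apply: st.
Qed.

Lemma leq_alpha {S : {set T}} : stable e S -> #|S| <= alpha e.
Proof. by move=> st; rewrite /alpha (bigD1 S) //= leq_maxl. Qed.

Lemma OmegaP {S : {set T}} :
  reflect (stable e S /\ #|S| = alpha e) (S \in Omega e).
Proof. by rewrite inE; apply: (iffP andP) => -[st /eqP]. Qed.

Lemma Omega_nonempty : exists S, S \in Omega e.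
Proof.
have st0 : stable e set0 by apply/stableP => x y; rewrite inE.
have [S st eqS] := @eq_bigmax_cond _ (stable e) (fun S => #|S|)
  (introT card_gt0P (ex_intro _ set0 st0)).
by exists S; apply/OmegaP.
Qed.

Lemma leq_cap_cup {A B S : {set T}} :
    A \subset B -> {in A & B, forall x y, ~~ e x y} -> S \in Omega e ->
  #|A| + #|B| <= #|S :&: A| + #|S :|: B|.
Proof.
move=> sAB nAB /OmegaP[stS cardS].
have stU : stable e (A :|: S :&: B).
  apply/stableP => x y; rewrite !inE.
  case/orP=> [xA | /andP[xS xB]] /orP[yA | /andP[yS yB]].
  (* As [A] lies in [B], the hypothesis [nAB] also makes [A] itself stable. *)
  - exact: nAB xA (subsetP sAB _ yA).
  - exact: nAB.
  - by rewrite e_sym; apply: nAB.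
  - exact: (stableP stS).
have := leq_alpha stU; have := cardsUI A (S :&: B); have := cardsUI S B.
by rewrite setICA (setIidPl sAB); lia.
Qed.

(** Induction on [r]. Keeping [S0] apart avoids the empty intersection, which is [setT]: for empty
    [r] both terms are [#|S0|]. *)
Lemma Omega_seq_cap_cup {S0 : {set T}} {r : seq {set T}} :
    S0 \in Omega e -> {subset r <= Omega e} ->
  2 * alpha e <= #|S0 :&: \bigcap_(S <- r) S| + #|S0 :|: \bigcup_(S <- r) S|.
Proof.
move=> S0O; have [stS0 cardS0] := OmegaP S0O.
elim: r => [|S r IHr] rO.
  by rewrite !big_nil setIT setU0 cardS0 mul2n addnn.
have SO : S \in Omega e by apply: rO; rewrite mem_head.
have {}rO : {subset r <= Omega e}.
  by move=> R Rr; apply: rO; rewrite inE Rr orbT.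
apply: leq_trans (IHr rO) _; rewrite !big_cons setICA setUCA.
apply: leq_cap_cup SO; first by rewrite subIset // subsetUl.
(* If [y] is in some member of the family, [x] is in that same stable member. *)
rewrite bigcap_seq bigcup_seq => x y /setIP[xS0 /bigcapP xr] /setUP[yS0 | ].
  exact: (stableP stS0).
by case/bigcupP=> R Rr yR; have [/stableP stR _] := OmegaP (rO R Rr); auto.
Qed.

Lemma double_alpha_leq_core_corona :
  2 * alpha e <= xi e + #|\bigcup_(S in Omega e) S|.
Proof.
have [S0 S0O] := Omega_nonempty.
have /(Omega_seq_cap_cup S0O) : {subset enum (Omega e) <= Omega e}.
  by move=> S; rewrite mem_enum.
rewrite !big_enum /= (setIidPr (bigcap_inf _ S0O)) //.
by rewrite (setUidPr (bigcup_sup _ S0O)).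
Qed.

Lemma core_neighbour_notin_corona {x y} :
  x \in core e -> e x y -> y \notin \bigcup_(S in Omega e) S.
Proof.
move=> /bigcapP xcore exy; apply/bigcupP => -[S SO yS].
by have [/stableP/(_ x y (xcore S SO) yS)/negP] := OmegaP SO.
Qed.

(** An isolated vertex missing from a maximum stable set could be added to it. *)
Lemma isolated_sub_core : irreflexive e -> isolated e \subset core e.
Proof.
move=> e_irr; apply/subsetP => x; rewrite inE => /forallP isox.
apply/bigcapP => S /OmegaP[stS cardS]; apply/negPn/negP => xS.
have /leq_alpha : stable e (x |: S).
  apply/stableP => y z /setU1P[-> _|yS /setU1P[->|zS]] //.
    by rewrite e_sym.
  exact: (stableP stS).
by rewrite cardsU1 xS cardS ltnn.
Qed.

Lemma core_neighbours_lt_xi :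
    #|T| < 2 * alpha e ->
  #|[set y | [exists x in core e, e x y]]| < xi e.
Proof.
move=> alpha_gt; set N := [set y | _]; set C := \bigcup_(S in Omega e) S.
have sNC : N \subset ~: C.
  apply/subsetP => y; rewrite !inE => /exists_inP[x xcore exy].
  exact: core_neighbour_notin_corona exy.
(* |N| + |C| <= n < 2 alpha <= xi + |C|. *)
rewrite -(ltn_add2r #|C|); apply: leq_trans double_alpha_leq_core_corona.
apply: leq_ltn_trans alpha_gt; rewrite -(cardsC C) addnC leq_add2l.
exact: subset_leq_card.
Qed.

End MaximumStableSets.

(* MathComp world; alpha(G) > n/2 is written n < 2 * alpha(G). *)
Theorem theorem4 (T : finType) (e : rel T)
    (e_sym : symmetric e) (e_irr : irreflexive e)
    (alpha_gt : #|T| < 2 * alpha e) :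
  [/\ #|isolated e| <> 1 -> 2 <= xi e,
      xi e = 1 -> #|isolated e| = 1
    & xi e <> 0].
Proof.
have ltN := core_neighbours_lt_xi _ _ e_sym alpha_gt.
have xi_gt0 : 0 < xi e by apply: leq_ltn_trans ltN.
have xi1 : xi e = 1 -> #|isolated e| = 1.
  move=> xi_eq1; rewrite -xi_eq1; congr #|pred_of_set _|; apply/eqP.
  rewrite eqEsubset isolated_sub_core //=; apply/subsetP => x xcore.
  rewrite inE; apply/forallP => y; apply/negP => exy.
  (* With [xi e = 1] the core has no neighbours, yet [y] would be one. *)
  move: ltN; rewrite xi_eq1 ltnS leqn0 cards_eq0 => /eqP/setP/(_ y).
  by rewrite !inE => /exists_inP[]; exists x.
split=> //; last by apply/eqP; rewrite -lt0n.
by move=> iso; rewrite ltn_neqAle xi_gt0 andbT eq_sym; apply/eqP => /xi1.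
Qed.
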